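(* Let $0<\epsilon<1$. There exist two constants $C_1,C_2>1$, depending only on $d$ and $\epsilon$, such that for every ortho-martingale difference field $(d_{\mathbf u})_{\mathbf u\in\mathbb N^d}$ and every $\mathbf n\in(\mathbb N^* )^d$, $$\sum_{\mathbf u=\mathbf 0}^{\mathbf n-\mathbf 1}\mathbb E\bigl[\Phi_d(|d_{\mathbf u}|)\bigr]\le C_1\max\Biggl\{\varphi_d^{-1}\Biggl(C_2\Bigl\|\sum_{\mathbf u=\mathbf 0}^{\mathbf n-\mathbf 1}d_{\mathbf u}\Bigr\|_{\Phi_d}\Biggr),\ \phi_d\circ f_\epsilon\Biggl(C_2\Bigl\|\sum_{\mathbf u=\mathbf 0}^{\mathbf n-\mathbf 1}d_{\mathbf u}\Bigr\|_{\Phi_d}\Biggr)\Biggr\},$$ where, for all $x\ge0$, $\phi_d(x)=x^{d+1}(\log(1+x))^{d-1}$, $\varphi_d(x)=x(\log(1+x))^{d-1}$ (with inverse $\varphi_d^{-1}$ on $[0,\infty)$) and $f_\epsilon(x)=x^{1/(1-\epsilon)}$.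
   Context: $d>1$ is an integer, $\mathbb N=\{0,1,2,\dots\}$, $\mathbb N^*=\{1,2,\dots\}$. Bold letters denote multi-indices, $\mathbf 0=(0,\dots,0)$, $\mathbf 1=(1,\dots,1)$, $\mathbf u\le\mathbf v$ means $u_k\le v_k$ for all $k$, $\mathbf i\wedge\mathbf j$ is the coordinatewise minimum, and $\sum_{\mathbf u=\mathbf 0}^{\mathbf n-\mathbf 1}$ is the sum over $\mathbf 0\le\mathbf u\le\mathbf n-\mathbf 1$. $\Phi_d(x)=x^2(\log(1+x))^{d-1}$ for $x\ge0$, and $\|f\|_{\Phi_d}=\inf\{t>0:\mathbb E[\Phi_d(|f|/t)]\le1\}$ (the right-hand side of the inequality is $+\infty$ if the norm is infinite). On a probability space $(\Omega,\mathcal F,\mathbb P)$, a commuting filtration is an increasing (for the order $\le$) family $(\mathcal F_{\mathbf k})_{\mathbf k\in\mathbb Z^d}$ of sub-sigma-fields of $\mathcal F$ such that, with $\mathbb E_{\mathbf i}[X]=\mathbb E[X\mid\mathcal F_{\mathbf i}]$, one has $\mathbb E_{\mathbf i}[\mathbb E_{\mathbf j}[X]]=\mathbb E_{\mathbf i\wedge\mathbf j}[X]$ for every integrable $X$ and all $\mathbf i,\mathbf j$. A field $(d_{\mathbf u})$ of real random variables is an ortho-martingale difference field (with respect to a commuting filtration) if each $d_{\mathbf n}$ is integrable and $\mathcal F_{\mathbf n}$-measurable and $\mathbb E_{\mathbf a}[d_{\mathbf n}]=0$ whenever there exists $k\in\{1,\dots,d\}$ with $a_k<n_k$. *)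

(* Defs.v *)
From HB Require Import structures.
From mathcomp Require Export all_boot all_order all_algebra.
From mathcomp Require Export all_classical all_reals all_analysis.
Export Order.TTheory GRing.Theory Num.Theory.
Export numFieldNormedType.Exports.

Set Implicit Arguments.
Unset Strict Implicit.
Unset Printing Implicit Defensive.

Local Open Scope classical_set_scope.
Local Open Scope ring_scope.

Section functions.
Context {R : realType}.
Implicit Types (d : nat) (eps x : R).

Definition Phi d x : R := x ^+ 2 * ln (1 + x) ^+ d.-1.

Definition phi d x : R := x ^+ d.+1 * ln (1 + x) ^+ d.-1.

Definition varphi d x : R := x * ln (1 + x) ^+ d.-1.

(* For [1 < d], [varphi d] is a bijection of [0, +oo[ onto itself; the
   default value 0 is only used outside of its image. *)
Definition varphi_inv d : R -> R := 'pinv_(fun=> 0) `[0, +oo[ (varphi d).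

Definition f_ eps x : R := x `^ (1 / (1 - eps)).

End functions.

Section multi_indices.
Context {d : nat}.

Definition mle (i j : {ffun 'I_d -> int}) : Prop := forall k, i k <= j k.

Definition mmin (i j : {ffun 'I_d -> int}) : {ffun 'I_d -> int} :=
  [ffun k => Num.min (i k) (j k)].

Definition mZ (u : {ffun 'I_d -> nat}) : {ffun 'I_d -> int} :=
  [ffun k => (u k)%:Z].

(* The multi-indices u with 0 <= u <= n - 1, for n with positive coordinates. *)
Definition box (n : {ffun 'I_d -> nat}) : set {ffun 'I_d -> nat} :=
  [set u | forall k, (u k < n k)%N].

End multi_indices.

Section probability.
Context {disp : measure_display} {T : measurableType disp} {R : realType}.
Variable P : probability T R.
Local Open Scope ereal_scope.

Definition Phi_norm (d : nat) (f : T -> R) : \bar R :=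
  ereal_inf [set t%:E | t in
    [set t : R | (0 < t)%R /\ 'E_P[fun w => Phi d (`|f w| / t)%R] <= 1]].

Definition sub_sigma_field (G : set_system T) : Prop :=
  sigma_algebra setT G /\ G `<=` measurable.

Definition measurable_wrt (G : set_system T) (X : T -> R) : Prop :=
  measurable_fun setT (X : g_sigma_algebraType G -> R).

Definition integrable_rv (X : T -> R) : Prop :=
  P.-integrable setT (EFin \o X).

(* Y is a version of E[X | G]; meant for an integrable X. *)
Definition is_cond_exp (G : set_system T) (X Y : T -> R) : Prop :=
  [/\ integrable_rv Y, measurable_wrt G Y &
      forall A, G A -> \int[P]_(w in A) (Y w)%:E = \int[P]_(w in A) (X w)%:E].

(* Conditional expectations being defined up to a null set, the commutation
   E_i[E_j[X]] = E_(i /\ j)[X] is an almost sure equality, stated for all the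
   versions Y of E_j[X], Z of E_i[Y] and W of E_(i /\ j)[X]. *)
Record commuting_filtration (d : nat)
    (F : {ffun 'I_d -> int} -> set_system T) : Prop := {
  cf_sub : forall i, sub_sigma_field (F i) ;
  cf_increasing : forall i j, mle i j -> F i `<=` F j ;
  cf_commute : forall (i j : {ffun 'I_d -> int}) (X Y Z W : T -> R),
    integrable_rv X ->
    is_cond_exp (F j) X Y -> is_cond_exp (F i) Y Z ->
    is_cond_exp (F (mmin i j)) X W ->
    Z = W %[ae P] }.

Record ortho_martingale_difference (d : nat)
    (F : {ffun 'I_d -> int} -> set_system T)
    (D : {ffun 'I_d -> nat} -> T -> R) : Prop := {
  omd_integrable : forall n, integrable_rv (D n) ;
  omd_measurable : forall n, measurable_wrt (F (mZ n)) (D n) ;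
  omd_cond_exp : forall (a : {ffun 'I_d -> int}) (n : {ffun 'I_d -> nat}),
    (exists k, (a k < (n k)%:Z)%R) ->
    is_cond_exp (F a) (D n) (fun=> 0%R) }.

End probability.

(* Main.v *)
From mathcomp Require Import measurable_realfun zify ring lra.
Require Import Defs.

(* [Phi d \o sqrt] is convex and superadditive, so by the parallelogram identity
     Phi |a + b| >= Phi |a| + g a * b + 2^-d Phi |b|
   for an explicit function g. If E[B | G] = 0 and A is G-measurable, the middle
   term integrates to 0, hence
     E Phi |A + B| >= E Phi |A| + 2^-d E Phi |B|.
   Splitting the sum S of the field along one coordinate after the other gives
     sum_u E Phi |D_u| <= 2^(d d) E Phi |S|,
   without any maximal or square function inequality. Finally E Phi |S| is at
   most t^2 (if t <= 1) or t^(d+1) (if t > 1) for some t < 2 N, where N is the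
   norm of S, and max (varphi^-1 (2 N)) (phi (f_eps (2 N))) dominates this up to
   a constant, since varphi x <= x on [0, 1] and f_eps x >= x on [1, +oo[. *)

Set Implicit Arguments.
Unset Strict Implicit.
Unset Printing Implicit Defensive.

Local Open Scope classical_set_scope.
Local Open Scope ring_scope.

(** * Real inequalities: growth and convexity of [Phi], lower bounds for the inverse of [varphi] *)

Section real_functions.
Context {R : realType}.
Implicit Types (d m : nat) (a b t x y : R).

(** Convexity of the power function. In the induction, multiplying by [a] leaves the slack
    [(m + 1) b^m (a - b)^2]. *)
Lemma exprn_tangent m a b : 0 <= a -> 0 <= b ->
  b ^+ m + m%:R * b ^+ m.-1 * (a - b) <= a ^+ m.
Proof.
move=> a0 b0; case: m => [|m]; first by rewrite mul0r mul0r !expr0 addr0.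
elim: m => [|m ih] /=; first by rewrite !expr1 expr0 !mul1r; lra.
have /(ler_wpM2l a0) := ih; rewrite -exprS; apply: le_trans.
rewrite -subr_ge0; set c := m.+1%:R in ih *.
have -> : m.+2%:R = c + 1 :> R by rewrite -natr1.
rewrite [b ^+ m.+2]exprS [m.+1.-1]/= [b ^+ m.+1]exprS.
have -> : a * (b * b ^+ m + c * b ^+ m * (a - b)) -
   (b * (b * b ^+ m) + (c + 1) * (b * b ^+ m) * (a - b)) =
   c * b ^+ m * (a - b) ^+ 2 by ring.
by rewrite mulr_ge0 ?sqr_ge0 // mulr_ge0 ?exprn_ge0.
Qed.

Lemma ln1D_ge0 x : 0 <= x -> 0 <= ln (1 + x).
Proof. by move=> x0; rewrite ln_ge0 // lerDl. Qed.

Lemma ler_ln1D x y : 0 <= x -> x <= y -> ln (1 + x) <= ln (1 + y).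
Proof. by move=> x0 xy; rewrite ler_ln ?posrE; lra. Qed.

Lemma ln1DB_le x y : 0 <= x -> 0 <= y ->
  ln (1 + x) - ln (1 + y) <= (x - y) / (1 + y).
Proof.
move=> x0 y0; rewrite -ln_div ?posrE; [|lra..].
have -> : (1 + x) / (1 + y) = 1 + (x - y) / (1 + y) by field; lra.
by apply: le_ln1Dx; rewrite ltr_pdivlMr; lra.
Qed.

(** Exponentiated, this is Bernoulli's inequality [1 + t x <= (1 + x)^t]. It follows from
    [expR ((t - 1) L) >= 1 + (t - 1) L] and [x <= (1 + x) L], where [L = ln (1 + x)]. *)
Lemma ln1DM_le t x : 1 <= t -> 0 <= x -> ln (1 + t * x) <= t * ln (1 + x).
Proof.
move=> t1 x0; set L := ln (1 + x).
have tx0 : 0 <= t * x by rewrite mulr_ge0 //; lra.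
rewrite -[leRHS]expRK ler_ln ?posrE ?expR_gt0//; last lra.
have -> : t * L = L + (t - 1) * L by ring.
rewrite expRD /L lnK ?posrE; last lra.
apply: (@le_trans _ _ ((1 + x) * (1 + (t - 1) * L))); last first.
  by rewrite ler_wpM2l ?expR_ge1Dx //; lra.
have xL : x <= (1 + x) * L.
  have := ln1DB_le (lexx 0) x0; rewrite addr0 ln1 !sub0r lerNl mulNr opprK.
  by rewrite ler_pdivrMr; [rewrite mulrC|lra].
have : (t - 1) * x <= (t - 1) * ((1 + x) * L) by rewrite ler_wpM2l //; lra.
by lra.
Qed.

Lemma Phi_ge0 d x : 0 <= x -> 0 <= Phi d x.
Proof. by move=> x0; rewrite mulr_ge0 ?exprn_ge0 ?ln1D_ge0. Qed.

Lemma Phi0 d : Phi d 0 = 0 :> R.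
Proof. by rewrite /Phi expr0n mul0r. Qed.

Lemma ler_Phi d x y : 0 <= x -> x <= y -> Phi d x <= Phi d y.
Proof.
move=> x0 xy; have y0 := le_trans x0 xy.
by apply: ler_pM; rewrite ?exprn_ge0 ?ln1D_ge0 //
  lerXn2r ?nnegrE ?ln1D_ge0 ?ler_ln1D.
Qed.

(** Each of the [d - 1] logarithms contributes a factor at most [t], on top of the [t ^+ 2] from the
    square. *)
Lemma PhiM_le d t x : (0 < d)%N -> 1 <= t -> 0 <= x ->
  Phi d (t * x) <= t ^+ d.+1 * Phi d x.
Proof.
case: d => // d _ t1 x0; have t0 : 0 <= t by lra.
rewrite /Phi /= exprMn.
have -> : t ^+ d.+2 * (x ^+ 2 * ln (1 + x) ^+ d) =
  t ^+ 2 * x ^+ 2 * (t * ln (1 + x)) ^+ d.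
  by rewrite exprMn -addn2 exprD; ring.
rewrite ler_wpM2l ?mulr_ge0 ?sqr_ge0 //.
by rewrite lerXn2r ?nnegrE ?ln1DM_le ?mulr_ge0 ?ln1D_ge0 // mulr_ge0.
Qed.

Lemma PhiM_le1 d t x : 0 <= t -> t <= 1 -> 0 <= x ->
  Phi d (t * x) <= t ^+ 2 * Phi d x.
Proof.
move=> t0 t1 x0; rewrite /Phi exprMn -mulrA.
rewrite !ler_wpM2l ?sqr_ge0 // lerXn2r ?nnegrE ?ln1D_ge0 ?mulr_ge0 //.
by rewrite ler_ln1D ?mulr_ge0 // ler_piMl.
Qed.

(* The derivative of [Phi d \o sqrt] at [x ^+ 2]. *)
Definition dPhi_sqrt d x : R := ln (1 + x) ^+ d.-1 +
  d.-1%:R / 2 * ln (1 + x) ^+ d.-1.-1 * (x / (1 + x)).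

(* [Phi d \o sqrt] is convex. *)
Lemma Phi_tangent d x y : 0 <= x -> 0 <= y ->
  Phi d x + dPhi_sqrt d x * (y ^+ 2 - x ^+ 2) <= Phi d y.
Proof.
move=> x0 y0; rewrite /Phi /dPhi_sqrt.
set m := d.-1; set a := ln (1 + x); set b := ln (1 + y).
have a0 : 0 <= a by exact: ln1D_ge0.
have b0 : 0 <= b by exact: ln1D_ge0.
have ab := exprn_tangent m b0 a0.
set c := m%:R * a ^+ m.-1 in ab.
have c0 : 0 <= c by rewrite mulr_ge0 ?exprn_ge0.
(* By [ab], [y ^+ 2 * b ^+ m] is at least [y ^+ 2 * a ^+ m] plus [c] times [y ^+ 2 * (b - a)], so
   only this weighted increment of the logarithm needs a bound. The slack is a non-negative multiple
   of [(y - x) ^+ 2]. *)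
have key : (y ^+ 2 - x ^+ 2) * (x / (1 + x)) / 2 <= y ^+ 2 * (b - a).
  have ba : y ^+ 2 * (y - x) / (1 + y) <= y ^+ 2 * (b - a).
    rewrite -mulrA ler_wpM2l ?sqr_ge0 //.
    have := ln1DB_le x0 y0; rewrite -/a -/b => h.
    have -> : (y - x) / (1 + y) = - ((x - y) / (1 + y)) by rewrite -mulNr opprB.
    lra.
  apply: le_trans ba; rewrite -subr_ge0.
  have -> : y ^+ 2 * (y - x) / (1 + y) -
    (y ^+ 2 - x ^+ 2) * (x / (1 + x)) / 2 =
    (y - x) ^+ 2 * (2 * y + x + x * y) / (2 * (1 + x) * (1 + y)).
    by field; lra.
  have xy0 : 0 <= x * y by rewrite mulr_ge0.
  have x1 : 0 <= 1 + x by lra.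
  by apply: divr_ge0; apply: mulr_ge0; rewrite ?sqr_ge0 ?mulr_ge0 //; lra.
have h1 := ler_wpM2l (sqr_ge0 y) ab.
have h2 := ler_wpM2l c0 key.
rewrite -/c.
have -> : m%:R / 2 * a ^+ m.-1 = c / 2 by rewrite /c; ring.
move: h1 h2; set X := x / (1 + x).
nra.
Qed.

Lemma dPhi_sqrt_ge0 d x : 0 <= x -> 0 <= dPhi_sqrt d x.
Proof.
move=> x0; rewrite addr_ge0 ?exprn_ge0 ?ln1D_ge0 //.
by rewrite !mulr_ge0 ?exprn_ge0 ?ln1D_ge0 ?invr_ge0 ?addr_ge0.
Qed.

(** By the chain rule through [x ^+ 2], the derivative of the even function [Phi d |x|]; the [g] of
    the overview. *)
Definition dPhi d x : R := 2 * x * dPhi_sqrt d `|x|.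

(* Convexity of [Phi d \o sqrt] and the parallelogram identity give
   [Phi |a + b| + Phi |a| >= 2 Phi |a + b / 2| + 2 Phi |b / 2|]. *)
Lemma Phi_increment d a b : (0 < d)%N ->
  Phi d `|a| + dPhi d a * b + Phi d `|b| / 2 ^+ d <= Phi d `|a + b|.
Proof.
(* Since [a + b = x + y] and [a = x - y], [q ^+ 2] is the mean of [(a + b) ^+ 2] and [a ^+ 2]: the
   first-order terms of the two tangents at [q] cancel when added. *)
move=> d0; pose x := a + b / 2; pose y := b / 2.
pose q := Num.sqrt (x ^+ 2 + y ^+ 2).
have q2 : q ^+ 2 = x ^+ 2 + y ^+ 2 by rewrite sqr_sqrtr ?addr_ge0 ?sqr_ge0.
have q0 : 0 <= q := sqrtr_ge0 _.
have h1 := Phi_tangent d q0 (normr_ge0 (a + b)).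
have h2 := Phi_tangent d q0 (normr_ge0 a).
have h3 := Phi_tangent d (normr_ge0 a) (normr_ge0 x).
(* Superadditivity: split the square as [q ^+ 2 = x ^+ 2 + y ^+ 2]; the logarithm at [q] dominates
   those at [|x|] and [|y|]. *)
have hq : Phi d `|x| + Phi d `|y| <= Phi d q.
  rewrite {3}/Phi q2 mulrDl lerD // /Phi real_normK ?num_real //.
    rewrite ler_wpM2l ?sqr_ge0 // lerXn2r ?nnegrE ?ln1D_ge0 ?ler_ln1D //.
    by rewrite -sqrtr_sqr ler_wsqrtr // lerDl sqr_ge0.
  rewrite ler_wpM2l ?sqr_ge0 // lerXn2r ?nnegrE ?ln1D_ge0 ?ler_ln1D //.
  by rewrite -sqrtr_sqr ler_wsqrtr // lerDr sqr_ge0.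
(* Doubling [|y|] costs [2 ^+ d.+1], of which one factor 2 is already present on the right. *)
have hb : Phi d `|b| / 2 ^+ d <= 2 * Phi d `|y|.
  rewrite ler_pdivrMr ?exprn_gt0 // mulrAC -exprS.
  apply: le_trans (PhiM_le d0 _ _); rewrite ?ler1n //.
  by rewrite /y normrM [`|2^-1|]gtr0_norm // mulrC divfK.
move: h1 h2 h3; rewrite q2 !real_normK ?num_real // /dPhi => h1 h2 h3.
set D := dPhi_sqrt d q in h1 h2; set E := dPhi_sqrt d `|a| in h3 *.
have E0 : 0 <= E by exact: dPhi_sqrt_ge0.
have h4 : E * (a * b) <= E * (x ^+ 2 - a ^+ 2).
  rewrite ler_wpM2l //.
  have -> : x ^+ 2 - a ^+ 2 = a * b + y ^+ 2 by rewrite /x /y; field.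
  by rewrite lerDl sqr_ge0.
have e1 : D * ((a + b) ^+ 2 - (x ^+ 2 + y ^+ 2)) +
          D * (a ^+ 2 - (x ^+ 2 + y ^+ 2)) = 0.
  by rewrite /x /y; field.
have -> : 2 * a * E * b = 2 * (E * (a * b)) by ring.
lra.
Qed.

Lemma continuous_inv1D_norm : continuous (fun x : R => (1 + `|x|)^-1).
Proof.
move=> x; apply: cvgV; first by rewrite gt_eqF // ltr_pwDl.
by apply: cvgD; [exact: cvg_cst|exact: norm_continuous].
Qed.

Lemma measurable_Phi d : measurable_fun setT (fun x : R => Phi d `|x|).
Proof.
apply: measurable_funM; apply: measurable_funX; first exact: normr_measurable.
apply: measurableT_comp; first exact: measurable_ln.
by apply: measurable_funD => //; exact: normr_measurable.
Qed.

Lemma measurable_dPhi d : measurable_fun setT (dPhi d : R -> R).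
Proof.
have mL m : measurable_fun setT (fun x : R => ln (1 + `|x|) ^+ m).
  apply: measurable_funX; apply: measurableT_comp; first exact: measurable_ln.
  by apply: measurable_funD => //; exact: normr_measurable.
apply: measurable_funM; first exact: measurable_funM.
apply: measurable_funD; first exact: mL.
apply: measurable_funM; first exact: measurable_funM.
apply: measurable_funM; first exact: normr_measurable.
apply: continuous_measurable_fun; exact: continuous_inv1D_norm.
Qed.

(** Surjectivity makes the pseudo-inverse [varphi_inv d] a right inverse of [varphi d] with values
    in [[0, +oo[]. *)
Lemma varphi_surj d : set_surj `[0, +oo[ `[0, +oo[ (varphi d : R -> R).
Proof.
move=> y /=; rewrite in_itv /= andbT => y0.
(* The summand [expR 1] forces [ln (1 + b) >= 1], hence [varphi d b >= b >= y]. *)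
pose b := expR 1 + y.
have e0 := expR_gt0 (1 : R).
have b0 : 0 <= b by rewrite /b; lra.
have yb : y <= varphi d b.
  apply: (@le_trans _ _ b); first by rewrite /b; lra.
  rewrite ler_peMr // exprn_ege1 // -[leLHS]expRK ler_ln ?posrE //; last lra.
  by rewrite /b; lra.
have [||x] := @IVT R (varphi d) 0 b y b0.
- apply/continuous_in_subspaceT => x; rewrite inE /= in_itv /= => /andP[x0 _].
  apply: cvgM; first exact: cvg_id.
  apply: (cvg_comp (fun z => ln (1 + z)) (fun z => z ^+ d.-1));
    last exact: exprn_continuous.
  apply: (cvg_comp (fun z => 1 + z) (@ln R)); last by apply: continuous_ln; lra.
  by apply: cvgD; [exact: cvg_cst|exact: cvg_id].
- by rewrite ge_min le_max /= yb orbT {1}/varphi mul0r y0.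
- rewrite in_itv /= => /andP[x0 _] xy; exists x => //=.
  by rewrite in_itv /= x0.
Qed.

Lemma varphi_inv_ge0 d y : 0 <= y -> 0 <= varphi_inv d y.
Proof.
move=> y0; have /= := @surjpinv_image_sub _ _ (fun=> 0) _ _ _ (@varphi_surj d)
  (varphi_inv d y).
rewrite in_itv /= andbT; apply; exists y => //.
by rewrite /= in_itv /= y0.
Qed.

Lemma varphi_invK d y : 0 <= y -> varphi d (varphi_inv d y) = y.
Proof.
move=> y0; rewrite /varphi_inv (surjpK _ (@varphi_surj d)) //.
by rewrite inE /= in_itv /= y0.
Qed.

(** On [[0, 1]] one has [ln (1 + x) <= x <= 1], so [varphi d x <= x] there. *)
Lemma le_varphi_inv d y : 0 <= y -> y <= 1 -> y <= varphi_inv d y.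
Proof.
move=> y0 y1; set x := varphi_inv d y.
have x0 : 0 <= x by exact: varphi_inv_ge0.
have [x1|/ltW] := leP x 1; last exact: le_trans.
rewrite -{1}(varphi_invK d y0) -/x ler_piMr // exprn_ile1 ?ln1D_ge0 //.
by apply: le_trans x1; apply: le_ln1Dx; lra.
Qed.

Lemma varphi_inv_ge1 d y : 1 <= y -> 1 <= varphi_inv d y.
Proof.
move=> y1; have y0 : 0 <= y by lra.
set x := varphi_inv d y.
have x0 : 0 <= x by exact: varphi_inv_ge0.
rewrite leNgt; apply/negP => x1.
suff : varphi d x < 1 by rewrite varphi_invK //; lra.
apply: (le_lt_trans _ x1); rewrite ler_piMr // exprn_ile1 ?ln1D_ge0 //.
by apply: le_trans (ltW x1); apply: le_ln1Dx; lra.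
Qed.

(** The first term of the maximum handles [t <= 1], the second [t > 1]. In the latter case the
    logarithm in [phi] is at least [ln 2], whence the constant [ln 2 ^- d.-1]. *)
Lemma scale_le_max_varphi_inv_phi (d : nat) (eps t y : R) :
  (0 < d)%N -> (0 < eps) -> (eps < 1) -> (0 < t) -> (t < y) ->
  ((if t <= 1 then t ^+ 2 else t ^+ d.+1) <=
  (1 + ln 2 ^- d.-1) * Num.max (varphi_inv d y) (phi d (f_ eps y))).
Proof.
move=> d0 eps0 eps1 t0 ty.
have l2 : (0 < ln 2 :> R) by rewrite ln_gt0 // ltr1n.
have l20 : (0 <= ln 2 ^- d.-1 :> R) by rewrite invr_ge0 exprn_ge0 // ltW.
have y0 : (0 <= y) by lra.
set v := varphi_inv d y; set p := phi d _.
have v0 : (0 <= v) by exact: varphi_inv_ge0.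
have max0 : (0 <= Num.max v p) by rewrite le_max v0.
rewrite mulrDl mul1r; case: ifPn => [t1|].
  apply: (@le_trans _ _ v); last first.
    by rewrite (@le_trans _ _ (Num.max v p)) ?le_max ?lexx // lerDl mulr_ge0.
  apply: (@le_trans _ _ t); first by rewrite expr2 ler_piMl // ltW.
  have [y1|/ltW y1] := leP y 1.
    by apply: le_trans (ltW ty) _; exact: le_varphi_inv.
  by apply: le_trans t1 _; exact: varphi_inv_ge1.
rewrite -ltNge => t1.
apply: (@le_trans _ _ (ln 2 ^- d.-1 * p)); last first.
  by rewrite ler_wpDl // ler_wpM2l // le_max lexx orbT.
rewrite mulrC ler_pdivlMr ?exprn_gt0 // /p /phi.
have yf : (y <= f_ eps y).
  rewrite /f_ -{1}(powRr1 y0) ler_powR //; first lra.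
  by rewrite ler_pdivlMr; lra.
apply: ler_pM.
- by rewrite exprn_ge0 // ltW.
- by rewrite exprn_ge0 // ltW.
- by rewrite lerXn2r ?nnegrE; lra.
- rewrite lerXn2r ?nnegrE ?ln1D_ge0 ?(ltW l2) //; first lra.
  by apply: ler_ln1D => //; lra.
Qed.

End real_functions.

Lemma finite_box (d : nat) (n : {ffun 'I_d -> nat}) : finite_set (box n).
Proof.
pose M := (\max_k n k)%N.
apply: (@sub_finite_set _ _ [set [ffun k => val (f k)] |
    f in [set: {ffun 'I_d -> 'I_M.+1}]]).
  move=> u un; exists [ffun k => inord (u k)] => //.
  apply/ffunP => k; rewrite !ffunE /= inordK // ltnS.
  exact: leq_trans (ltnW (un k)) (leq_bigmax k).
exact/finite_image/finite_finset.
Qed.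

Local Open Scope ereal_scope.

(** * Increments with zero conditional mean *)

Section martingale_increments.
Context {disp : measure_display} {T : measurableType disp} {R : realType}.
Variable P : probability T R.

Lemma measurable_wrt_preimage (G : set_system T) (X : T -> R) (Y : set R) :
  sub_sigma_field G -> measurable_wrt G X -> measurable Y -> G (X @^-1` Y).
Proof.
move=> [sG _] mX mY; have := mX measurableT Y mY.
by rewrite setTI /measurable /= (sigma_algebra_id sG).
Qed.

Lemma measurable_wrtW (G H : set_system T) (X : T -> R) :
  sub_sigma_field G -> sub_sigma_field H -> G `<=` H ->
  measurable_wrt G X -> measurable_wrt H X.
Proof.
move=> sG sH GH mX _ Y mY; rewrite setTI /measurable /= (sigma_algebra_id sH.1).
by apply: GH; exact: measurable_wrt_preimage.
Qed.

(** Subtracting [r * X] from [f] does not change the integral over [E]. As [r] is a constant,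
    [r * X] is integrable, which could fail for a random unbounded coefficient. *)
Lemma le_integral_mean0 (E : set T) (u f X : T -> R) (r : R) :
  measurable E -> measurable_fun setT u -> measurable_fun setT f ->
  (forall w, 0 <= u w)%R -> (forall w, 0 <= f w)%R ->
  integrable_rv P X -> \int[P]_(w in E) (X w)%:E = 0 ->
  (forall w, E w -> u w + r * X w <= f w)%R ->
  \int[P]_(w in E) (u w)%:E <= \int[P]_(w in E) (f w)%:E.
Proof.
move=> mE mu mf u0 f0 iX X0 uXf.
have mEu : measurable_fun E (EFin \o u).
  by apply/measurable_EFinP; exact: measurable_funTS.
have mEf : measurable_fun E (EFin \o f).
  by apply/measurable_EFinP; exact: measurable_funTS.
(* Linearity of the integral is used only once [f] is known to be integrable on [E]. *)
have [fi|] := ltP (\int[P]_(w in E) (f w)%:E) +oo; last first.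
  by rewrite leye_eq => /eqP ->; exact: leey.
have iXE : P.-integrable E (EFin \o X).
  exact: integrableS iX.
have ifE : P.-integrable E (EFin \o f).
  apply/integrableP; split => //.
  by under eq_integral do rewrite /= ger0_norm //.
have irX : P.-integrable E (fun w => (- r)%:E * (X w)%:E).
  exact: integrableZl.
have -> : \int[P]_(w in E) (f w)%:E =
    \int[P]_(w in E) ((f w)%:E + (- r)%:E * (X w)%:E).
  rewrite integralD // integralZl // [X in _ * X]X0 mule0 adde0 //.
apply: ge0_le_integral => //.
- by move=> w _; rewrite lee_fin.
- exact: emeasurable_funD mEf (measurable_int _ irX).
- move=> w /uXf; rewrite -EFinM -EFinD lee_fin; lra.
Qed.

(* The sets where [dPhi d A] lies in [j * e, (j + 1) * e[] are [G]-measurable;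
   on each of them [dPhi d A] may be replaced by [j * e], at the cost of
   [e * |B|]. *)
Lemma Phi_martingale_increment (d : nat) (G : set_system T) (A B : T -> R) :
  (0 < d)%N -> sub_sigma_field G -> measurable_wrt G A ->
  is_cond_exp P G B (fun=> 0%R) -> integrable_rv P B ->
  'E_P[fun w => Phi d `|A w|%R] + (2 ^- d)%:E * 'E_P[fun w => Phi d `|B w|%R] <=
  'E_P[fun w => Phi d `|(A w + B w)%R|%R].
Proof.
move=> d0 sG mAG [_ _ cB] iB.
have mA : measurable_fun setT A.
  move=> _ Y mY; rewrite setTI; apply: sG.2.
  exact: measurable_wrt_preimage.
have mB : measurable_fun setT B.
  by apply/measurable_EFinP; exact: measurable_int iB.
have mPA : measurable_fun setT (fun w => Phi d `|A w|%R).
  exact: measurableT_comp (measurable_Phi d) mA.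
have mPB : measurable_fun setT (fun w => Phi d `|B w|%R).
  exact: measurableT_comp (measurable_Phi d) mB.
have mPS : measurable_fun setT (fun w => Phi d `|(A w + B w)%R|%R).
  by apply: measurableT_comp (measurable_Phi d) _; exact: measurable_funD.
have mdA : measurable_wrt G (fun w => dPhi d (A w)).
  exact: measurableT_comp (measurable_dPhi d) mAG.
pose u w := (Phi d `|A w| + 2 ^- d * Phi d `|B w|)%R.
have u0 w : (0 <= u w)%R.
  by rewrite addr_ge0 ?Phi_ge0 // mulr_ge0 ?Phi_ge0 // invr_ge0 exprn_ge0.
have mu : measurable_fun setT u.
  by apply: measurable_funD => //; exact: measurable_funM.
rewrite expectation.unlock -ge0_integralZl_EFin //; first last.
- exact/measurable_EFinP.
- by move=> w _; rewrite lee_fin Phi_ge0.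
rewrite -ge0_integralD //; first last.
- by apply/measurable_EFinP; exact: measurable_funM.
- by move=> w _; rewrite -EFinM lee_fin mulr_ge0 ?Phi_ge0.
- exact/measurable_EFinP.
- by move=> w _; rewrite lee_fin Phi_ge0.
rewrite [leLHS](_ : _ = \int[P]_x (u x)%:E) //.
set b := \int[P]_w `|(B w)%:E|.
have bfin : b \is a fin_num.
  by apply/fin_numPlt; rewrite (lt_le_trans _ (integral_ge0 _ _)) //=;
    case/integrableP: iB.
(* The discretisation error is [e] times the finite first absolute moment of [B]; [e] tends to 0 at
   the end. *)
have main (e : R) : (0 < e)%R ->
    \int[P]_x (u x)%:E <= \int[P]_x (Phi d `|A x + B x|)%:E + e%:E * b.
  move=> e0.
  pose f w := (Phi d `|A w + B w| + e * `|B w|)%R.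
  have f0 w : (0 <= f w)%R.
    by rewrite addr_ge0 ?Phi_ge0 // mulr_ge0 // ltW.
  have mf : measurable_fun setT f.
    apply: measurable_funD => //; apply: measurable_funM => //.
    exact: measurableT_comp.
  have -> : \int[P]_x (Phi d `|A x + B x|)%:E + e%:E * b = \int[P]_x (f x)%:E.
    rewrite /b -ge0_integralZl_EFin //; last 2 first.
    - by apply/measurable_EFinP; exact: measurableT_comp.
    - exact: ltW.
    rewrite -ge0_integralD //.
    - by move=> w _; rewrite lee_fin Phi_ge0.
    - exact/measurable_EFinP.
    - by move=> w _; rewrite mule_ge0 // lee_fin ltW.
    - apply/measurable_EFinP; apply: measurable_funM => //.
      exact: measurableT_comp.
  (* A countable partition indexed by the integers, enumerated through [pickle]; a natural number
     that codes no integer gets the empty set. *)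
  pose F (k : nat) := if pickle_inv k is Some j then
    (fun w => dPhi d (A w)) @^-1`
      [set` `[((j : int)%:~R * e)%R, ((j + 1)%:~R * e)%R[]
    else set0.
  have GF k : G (F k).
    rewrite /F; case: pickle_inv => [j|]; last by case: sG => -[].
    exact: measurable_wrt_preimage.
  have mF k : measurable (F k) by exact: sG.2.
  have FE k w : F k w -> pickle_inv k = Some (Num.floor (dPhi d (A w) / e)).
    rewrite /F; case: pickle_inv => [j|//] /=.
    rewrite in_itv /= -ler_pdivlMr // -ltr_pdivrMr // => h; congr Some.
    by rewrite (floor_def h).
  have tF : trivIset setT F.
    move=> i j _ _ [w [/FE iw /FE jw]].
    by rewrite -(@pickle_invK int i) -(@pickle_invK int j) iw jw.
  have UF : \bigcup_k F k = setT.
    rewrite -subTset => w _.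
    have := floor_itv (dPhi d (A w) / e); move: (Num.floor _) => z.
    rewrite ler_pdivlMr // ltr_pdivrMr // => zw.
    by exists (pickle z); [exact: I|rewrite /F pickleK_inv /= in_itv].
  rewrite -UF ge0_integral_bigcup //; last 2 first.
  - by apply/measurable_EFinP; rewrite UF.
  - by move=> w _; rewrite lee_fin.
  rewrite ge0_integral_bigcup //; last 2 first.
  - by apply/measurable_EFinP; rewrite UF.
  - by move=> w _; rewrite lee_fin.
  apply: lee_nneseries => k _.
    by move=> _; apply: integral_ge0 => w _; rewrite lee_fin.
  (* The default 0 occurs only when [F k] is empty. *)
  pose r := odflt 0%R (pickle_inv k) : int.
  apply: (@le_integral_mean0 _ _ _ B (r%:~R * e)) => //.
    by rewrite -cB // integral0.
  move=> w Fw; have := Phi_increment (A w) (B w) d0.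
  have : (`|dPhi d (A w) - r%:~R * e| <= e)%R.
    have := FE _ _ Fw; move: Fw; rewrite /F /r; case: pickle_inv => [j /=|//].
    rewrite in_itv /= => /andP[h1 h2] _.
    by rewrite ger0_norm; move: h1 h2; rewrite intrD; lra.
  move=> /(ler_wpM2r (normr_ge0 (B w))); rewrite -normrM.
  have := ler_norm (- ((dPhi d (A w) - r%:~R * e) * B w)).
  by rewrite normrN /u /f mulrC; lra.
apply: (introT (lee_addgt0Pr _ _)) => e e0.
have b0 : 0 <= b by exact: integral_ge0.
(* The [+ 1] keeps the denominator positive when [b = 0]. *)
apply: le_trans (main (e / (fine b + 1))%R _) _.
  by rewrite divr_gt0 // ltr_wpDl // fine_ge0.
rewrite leeD2l // -[X in _ * X](fineK bfin) -EFinM lee_fin mulrAC ler_pdivrMr.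
  by rewrite ler_wpM2l // ?ltW // ltrDl.
by rewrite ltr_wpDl // fine_ge0.
Qed.

Lemma integrable_rv_sum (I : Type) (s : seq I) (X : I -> T -> R) :
  (forall i, integrable_rv P (X i)) ->
  integrable_rv P (fun w => \sum_(i <- s) X i w)%R.
Proof.
move=> iX; rewrite /integrable_rv.
have -> : EFin \o (fun w => \sum_(i <- s) X i w)%R =
          (fun w => \sum_(i <- s) (X i w)%:E).
  by apply/funext => w /=; rewrite sumEFin.
apply: (@integrable_sum _ _ _ P setT measurableT I s xpredT
  (fun i => EFin \o X i)) => i _.
exact: iX.
Qed.

(** * Slicing an ortho-martingale difference field coordinate by coordinate *)

Section ortho_martingale.
Variables (d : nat) (F : {ffun 'I_d -> int} -> set_system T)
  (D : {ffun 'I_d -> nat} -> T -> R).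
Hypotheses (d0 : (0 < d)%N) (cF : commuting_filtration P F)
  (mD : ortho_martingale_difference P F D).
Local Notation index := {ffun 'I_d -> nat}.
Implicit Types (s : seq index) (k : 'I_d) (a : {ffun 'I_d -> int}).

(** Index sets are lists, so that constraining a coordinate is a [filter] and no box structure has
    to be maintained. *)
Definition Phi_moment s : \bar R :=
  'E_P[fun w => Phi d `|\sum_(v <- s) D v w|%R].

Lemma Phi_moment_ge0 s : 0 <= Phi_moment s.
Proof. by apply: expectation_ge0 => w; exact: Phi_ge0. Qed.

Lemma Phi_moment_seq1 v : Phi_moment [:: v] = 'E_P[fun w => Phi d `|D v w|%R].
Proof. by congr expectation; apply/funext => w; rewrite big_seq1. Qed.

Lemma is_cond_exp_sum s a :
  (forall v, v \in s -> exists k, (a k < (v k)%:Z)%R) ->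
  is_cond_exp P (F a) (fun w => \sum_(v <- s) D v w)%R (fun=> 0%R).
Proof.
move=> sa; split.
- exact: integrable0.
- exact: measurable_cst.
- move=> E FE; rewrite integral0.
  have mE : measurable E by exact: (cf_sub cF a).2.
  under [RHS]eq_integral do rewrite -sumEFin.
  rewrite integral_sum //; last first.
    by move=> v; exact: integrableS (omd_integrable mD v).
  rewrite big_seq big1 // => v /sa va.
  have [_ _ /(_ E FE)] := omd_cond_exp mD va.
  by rewrite integral0.
Qed.

Lemma measurable_wrt_sum s a :
  (forall v, v \in s -> mle (mZ v) a) ->
  measurable_wrt (F a) (fun w => \sum_(v <- s) D v w)%R.
Proof.
elim: s => [|v s ih] sa.
  under [X in measurable_wrt _ X]eq_fun do rewrite big_nil.
  exact: measurable_cst.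
under [X in measurable_wrt _ X]eq_fun do rewrite big_cons.
apply: measurable_funD; last first.
  by apply: ih => u us; apply: sa; rewrite inE us orbT.
have mv : measurable_wrt (F (mZ v)) (D v) := omd_measurable mD (n := v).
have Fva : F (mZ v) `<=` F a.
  by apply: (cf_increasing cF); apply: sa; exact: mem_head.
exact: (measurable_wrtW (cf_sub cF _) (cf_sub cF _) Fva mv).
Qed.

(** The slice [v k = m] is an increment with zero conditional mean over the partial sum of the
    slices below [m]. *)
Lemma Phi_moment_increment s k m :
  Phi_moment [seq v : index <- s | (v k < m)%N] +
    (2 ^- d)%:E * Phi_moment [seq v : index <- s | v k == m] <=
  Phi_moment [seq v : index <- s | (v k < m.+1)%N].
Proof.
(* [F a] must contain the information of all slices below [m] and none of the order [m] along [k]: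
   coordinate [k] is [m - 1] (equal to -1 when [m = 0]), the others are large enough for all of
   [s]. *)
pose a : {ffun 'I_d -> int} := [ffun i => if i == k then m%:Z - 1
  else (\max_(v <- s) (v : index) i)%N%:Z]%R.
have -> : Phi_moment [seq v : index <- s | (v k < m.+1)%N] =
  'E_P[fun w => Phi d `|(
    \sum_(v <- [seq v : index <- s | (v k < m)%N]) D v w +
    \sum_(v <- [seq v : index <- s | v k == m]) D v w)%R|%R].
  congr expectation; apply/funext => w; congr (Phi d `|_|)%R.
  rewrite !big_filter (bigID (fun v : index => v k == m)) /= addrC.
  by congr (_ + _)%R; apply: eq_bigl => v; rewrite ltnS; lia.
apply: (Phi_martingale_increment (G := F a)) => //.
- exact: (cf_sub cF a).
- apply: measurable_wrt_sum => v; rewrite mem_filter => /andP[vm vs] i.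
  rewrite !ffunE; case: eqP => [->|_]; first by lia.
  rewrite lez_nat.
  exact: (@leq_bigmax_seq _ _ xpredT (fun v : index => v i)).
- apply: is_cond_exp_sum => v; rewrite mem_filter => /andP[/eqP vm _].
  by exists k; rewrite ffunE eqxx vm; lia.
- exact: integrable_rv_sum (omd_integrable mD).
Qed.

(** Iterating the increment inequality keeps coefficient 1 on the partial sum, so [2 ^- d] is paid
    once per coordinate and not once per slice. *)
Lemma Phi_moment_coordinate s k m :
  (2 ^- d)%:E * \sum_(i < m) Phi_moment [seq v : index <- s | v k == i] <=
  Phi_moment [seq v : index <- s | (v k < m)%N].
Proof.
elim: m => [|m ih]; first by rewrite big_ord0 mule0 Phi_moment_ge0.
apply: le_trans (Phi_moment_increment s k m).
rewrite big_ord_recr /= ge0_muleDr ?sume_ge0 ?leeD2r ?Phi_moment_ge0 //.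
by move=> i _; exact: Phi_moment_ge0.
Qed.

(** Induction on the number [j] of leading coordinates that may vary in [s], each costing a factor
    [2 ^- d]. With none left, the duplicate-free list has at most one entry. *)
Lemma sum_Phi_moment_le s j : uniq s ->
  {in s &, forall u v : index, forall k : 'I_d, (j <= k)%N -> u k = v k} ->
  (2 ^- d ^+ j)%:E * \sum_(v <- s) Phi_moment [:: v] <= Phi_moment s.
Proof.
elim: j s => [|j ih] s us sj.
  rewrite expr0 mul1e; case: s us sj => [_ _|u [|v s]].
  - by rewrite big_nil Phi_moment_ge0.
  - by rewrite big_seq1.
  move=> us /(_ u v); rewrite !inE !eqxx orbT => /(_ isT isT) uv.
  have {}uv : u = v by apply/ffunP => k; exact: uv.
  by move: us; rewrite uv /= inE eqxx.
(* If [j >= d] there is no coordinate [j] to slice, and the extra factor only weakens the claim. *)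
have [jd|dj] := ltnP j d; last first.
  apply: le_trans (ih _ us _); last first.
    by move=> u v us' vs k jk; have := leq_trans dj jk; rewrite leqNgt ltn_ord.
  rewrite lee_wpmul2r ?sume_ge0 // => [v _|]; first exact: Phi_moment_ge0.
  rewrite lee_fin exprS ler_piMl ?exprn_ge0 ?invr_ge0 // invf_le1 ?exprn_gt0 //.
  by rewrite exprn_ege1 // ler1n.
(* [m] exceeds every [k]-th coordinate in [s], so the slices below [m] exhaust [s]. *)
pose k := Ordinal jd; pose m := (\max_(v <- s) (v : index) k).+1.
have sm v : v \in s -> (v k < m)%N.
  by move=> vs; apply: (@leq_bigmax_seq _ _ xpredT (fun v : index => v k)).
have {2}-> : s = [seq v : index <- s | (v k < m)%N].
  by apply/esym/all_filterP/allP.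
apply: le_trans (Phi_moment_coordinate s k m).
rewrite exprS EFinM -muleA lee_wpmul2l ?lee_fin ?invr_ge0 ?exprn_ge0 //.
have -> : \sum_(v <- s) Phi_moment [:: v] =
    \sum_(i < m) \sum_(v <- [seq v : index <- s | v k == i]) Phi_moment [:: v].
  under [RHS]eq_bigr do rewrite big_filter.
  rewrite (exchange_big_dep xpredT) //= big_seq [RHS]big_seq.
  by apply: eq_bigr => v /sm vm; rewrite (big_pred1 (Ordinal vm)).
rewrite ge0_sume_distrr; last first.
  by move=> i _; apply: sume_ge0 => v _; exact: Phi_moment_ge0.
apply: lee_sum => i _; apply: ih; first exact: filter_uniq.
move=> u v; rewrite !mem_filter => /andP[/eqP ui us'] /andP[/eqP vi vs] l.
rewrite leq_eqVlt => /predU1P[jl|]; last exact: sj.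
by have -> : l = k; [exact/val_inj|rewrite ui vi].
Qed.

End ortho_martingale.

End martingale_increments.

(** * From the Orlicz norm to the moment *)

Section Phi_norm.
Context {disp : measure_display} {T : measurableType disp} {R : realType}.
Variable P : probability T R.
(** Write [|S|] as [t] times [|S| / t] and extract [t] with [PhiM_le1] or [PhiM_le], according to
    its size. *)
Lemma expectation_Phi_le (d : nat) (S : T -> R) (t : R) :
  (0 < d)%N -> measurable_fun setT S -> (0 < t)%R ->
  'E_P[fun w => Phi d (`|S w| / t)%R] <= 1 ->
  'E_P[fun w => Phi d `|S w|%R] <=
    (if (t <= 1)%R then t ^+ 2 else t ^+ d.+1)%:E.
Proof.
move=> d0 mS t0; rewrite expectation.unlock => Pt.
set K := (if _ then _ else _).
have K0 : (0 <= K)%R by rewrite /K; case: ifP => _; rewrite exprn_ge0 // ltW.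
have PK w : (Phi d `|S w| <= K * Phi d (`|S w| / t))%R.
  have St : (0 <= `|S w| / t)%R by rewrite divr_ge0 // ltW.
  have {1}-> : `|S w|%R = (t * (`|S w| / t))%R by rewrite mulrC divfK ?gt_eqF.
  rewrite /K; case: ifPn => [t1|]; first by rewrite PhiM_le1 // ltW.
  by rewrite -ltNge => /ltW t1; exact: PhiM_le.
have mPS : measurable_fun setT (fun w => Phi d `|S w|%R).
  exact: measurableT_comp (measurable_Phi d) mS.
have mPSt : measurable_fun setT (fun w => Phi d (`|S w| / t)%R).
  have -> : (fun w => Phi d (`|S w| / t)%R) = (fun w => Phi d `|S w / t|%R).
    by apply/funext => w; rewrite normrM [in RHS](@gtr0_norm _ t^-1) ?invr_gt0.
  by apply: measurableT_comp (measurable_Phi d) _; exact: measurable_funM.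
apply: (@le_trans _ _ (\int[P]_w (K%:E * (Phi d (`|S w| / t))%:E))).
  apply: ge0_le_integral => //.
  - by move=> w _; rewrite lee_fin Phi_ge0.
  - exact/measurable_EFinP.
  - by apply/measurable_EFinP; exact: measurable_funM.
  - by move=> w _; rewrite -EFinM lee_fin.
rewrite ge0_integralZl_EFin //.
- by rewrite -[leRHS]mule1 lee_wpmul2l.
- by move=> w _; rewrite lee_fin Phi_ge0 // divr_ge0 // ltW.
- exact/measurable_EFinP.
Qed.

Lemma Phi_norm_ge0 (d : nat) (S : T -> R) : 0 <= Phi_norm P d S.
Proof. by apply: le_ereal_inf_tmp => _ [t [t0 _] <-]; rewrite lee_fin ltW. Qed.

(** An admissible [t] below any level above the norm suffices, so attainment of the infimum need not
    be shown. *)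
Lemma Phi_norm_lt (d : nat) (S : T -> R) (r : R) : Phi_norm P d S < r%:E ->
  exists t : R, [/\ (0 < t)%R, (t < r)%R &
    'E_P[fun w => Phi d (`|S w| / t)%R] <= 1].
Proof.
by move=> /ereal_inf_lt[_ [t [t0 St] <-]]; rewrite lte_fin; exists t.
Qed.

End Phi_norm.

Theorem lemma3p8 (R : realType) (d : nat) (hd : (1 < d)%N)
    (eps : R) (heps0 : (0 < eps)%R) (heps1 : (eps < 1)%R) :
  exists C1 C2 : R, [/\ (1 < C1)%R, (1 < C2)%R &
    forall (disp : measure_display) (T : measurableType disp)
      (P : probability T R) (F : {ffun 'I_d -> int} -> set_system T)
      (D : {ffun 'I_d -> nat} -> T -> R),
      commuting_filtration P F -> ortho_martingale_difference P F D ->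
      forall n : {ffun 'I_d -> nat}, (forall k, (0 < n k)%N) ->
      let N := Phi_norm P d (fun w => \sum_(u \in box n) D u w)%R in
      \sum_(u \in box n) 'E_P[fun w => Phi d `|D u w|%R] <=
      C1%:E * maxe (er_map (varphi_inv d) (C2%:E * N))
                   (er_map (phi d \o f_ eps) (C2%:E * N))].
Proof.
have d0 : (0 < d)%N by exact: ltnW.
(* The inverse of the total loss [(2 ^- d) ^+ d] over the [d] coordinates. *)
pose c : R := ((2 ^+ d) ^+ d)%R.
have c1 : (1 <= c)%R by rewrite !exprn_ege1 // ler1n.
have l2 : (0 < ln 2 ^- d.-1 :> R)%R.
  by rewrite invr_gt0 exprn_gt0 // ln_gt0 // ltr1n.
(* The value 2 for [C2] leaves room for an admissible [t] strictly below [2 N] when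
   [0 < N < +oo]. *)
exists (c * (1 + ln 2 ^- d.-1))%R, 2%R; split.
- by rewrite (le_lt_trans c1) // ltr_pMr; lra.
- by rewrite ltr1n.
move=> disp T P F D cF mD n _; set N := Phi_norm _ _ _; move=> /=.
pose s : seq {ffun 'I_d -> nat} := finmap.enum_fset (fset_set (box n)).
pose S w := (\sum_(v <- s) D v w)%R.
have NE : N = Phi_norm P d S.
  congr (Phi_norm P d _); apply/funext => w.
  by rewrite fsbig_finite //; exact: finite_box.
have mS : measurable_fun setT S.
  apply/measurable_EFinP; apply: measurable_int.
  exact: integrable_rv_sum (omd_integrable mD).
have sumS : \sum_(u \in box n) 'E_P[fun w => Phi d `|D u w|%R] <=
    c%:E * 'E_P[fun w => Phi d `|S w|%R].
  rewrite fsbig_finite; last exact: finite_box.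
  have := @sum_Phi_moment_le _ _ _ P d F D d0 cF mD s d (finmap.fset_uniq _).
  move=> /(_ _)/wrap[u v _ _ k|]; first by rewrite leqNgt ltn_ord.
  rewrite exprVn lee_pdivrMl; last by rewrite !exprn_gt0.
  by rewrite (eq_bigr _ (fun v _ => Phi_moment_seq1 P D v)).
apply: le_trans sumS _; rewrite EFinM -muleA.
apply: lee_wpmul2l; first by rewrite lee_fin; lra.
have := Phi_norm_ge0 P d S; rewrite -NE.
(* For an infinite norm, [er_map] sends [+oo] to [+oo] and the bound is trivial. *)
case EN : N => [r| |] // r0; last first.
  rewrite mulry gtr0_sg // mul1e /= maxxx.
  by rewrite mulry gtr0_sg ?mul1e ?leey // addr_gt0.
rewrite /= -EFin_max -EFinM.
move: r0; rewrite lee_fin le_eqVlt => /predU1P[r0|r0].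
  (* With zero norm there is no room below [2 N]. Instead, arbitrarily small [t] are admissible, so
     the moment of [S] vanishes. *)
  apply: (@le_trans _ _ 0).
    apply/lee_addgt0Pr => e e0; rewrite add0e.
    have [|t [t0 te St]] := @Phi_norm_lt _ _ _ P d S (Num.min e 1%R).
      by rewrite -NE EN -r0 lte_fin lt_min e0 ltr01.
    apply: le_trans (expectation_Phi_le d0 mS t0 St) _; rewrite lee_fin.
    move: te; rewrite lt_min => /andP[te t1]; rewrite (ltW t1) expr2.
    by apply: le_trans (ltW te); rewrite ler_piMl ?ltW.
  by rewrite -r0 mulr0 lee_fin mulr_ge0 //; [lra|rewrite le_max varphi_inv_ge0].
have [|t [t0 tr St]] := @Phi_norm_lt _ _ _ P d S (2 * r)%R.
  by rewrite -NE EN lte_fin; lra.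
apply: le_trans (expectation_Phi_le d0 mS t0 St) _; rewrite lee_fin.
exact: scale_le_max_varphi_inv_phi.
Qed.
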